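(* Let $T=U|T|\in\mathcal{M}_m(\mathbb{C})$ be an invertible and centered $m\times m$ complex matrix, and let $\mathfrak{m}_f$ be an operator mean with representing function $f$ satisfying $f(x)\le 1-\lambda+\lambda x$ for all $x>0$, where $\lambda:=f'(1)\in(0,1)$. Then the sequence $\{\Delta_{\mathfrak{m}_f}^n(T)\}$ converges to a normal matrix as $n\to\infty$.
   Context: $|T|=(T^*T)^{1/2}$; for invertible $T$ the factor $U$ in the polar decomposition $T=U|T|$ is unitary. Operator mean: $\mathfrak{m}_f$ corresponds to a representing function $f:(0,\infty)\to(0,\infty)$, operator monotone with $f(1)=1$; for positive invertible $A,B$, $\mathfrak{m}_f(A,B)=A^{1/2}f(A^{-1/2}BA^{-1/2})A^{1/2}$. Induced Aluthge transformation: for invertible $T=U|T|$ with spectral decomposition $|T|=\int_{\sigma(|T|)}s\,dE_s$, define $\Delta_{\mathfrak{m}_f}(T)=\Delta_f(T):=\int_{\sigma(|T|)}\int_{\sigma(|T|)} s f(t/s)\,dE_s\,U\,dE_t$; for a matrix with $|T|=\sum_i s_iE_i$ ($s_i$ distinct eigenvalues, $E_i$ spectral projections) this is $\Delta_f(T)=\sum_{i,j}s_i f(s_j/s_i)E_iUE_j$. Iterates: $\Delta_f^0(T)=T$, $\Delta_f^n(T)=\Delta_f(\Delta_f^{n-1}(T))$. $T=U|T|$ is centered if $\{U^{*m}|T|U^m,\ |T|,\ U^n|T|U^{*n}: n,m=1,2,\dots\}$ is a commuting set. *)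

(* Defs.v *)
From HB Require Import structures.
From mathcomp Require Import all_boot all_order all_algebra.
From mathcomp Require Import all_classical all_reals all_analysis.
From mathcomp Require Import complex.

Set Implicit Arguments.
Unset Strict Implicit.
Unset Printing Implicit Defensive.

Import Order.TTheory GRing.Theory Num.Theory.
Import numFieldNormedType.Exports.

Local Open Scope classical_set_scope.
Local Open Scope ring_scope.
Local Open Scope complex_scope.
Local Open Scope sesquilinear_scope.

(* The topology of the complex modulus on [R[i]]. The matrix types ['M[R[i]]_m]
   inherit from it the entrywise topology. *)
HB.instance Definition _ (R : realType) :=
  NormedModule.copy R[i] ((R[i] : numFieldType) : Type)^o.

Section MatrixFunctions.
Variable R : realType.
Local Notation C := R[i].

(* Over [C], a nonnegative quadratic form is in particular real, so that the
   Hermitian symmetry of [A] is implied. *)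
Definition possemidef n (A : 'M[C]_n) : Prop :=
  forall v : 'cV[C]_n, 0 <= (v^t* *m A *m v) ord0 ord0.

Definition posdef n (A : 'M[C]_n) : Prop := possemidef A /\ A \in unitmx.

Definition loewner_le n (A B : 'M[C]_n) : Prop := possemidef (B - A).

(* The distinct eigenvalues of a normal matrix: see [mem_eigvals]. *)
Definition eigvals n (A : 'M[C]_n) : seq C :=
  undup [seq spectral_diag A ord0 i | i <- enum 'I_n].

(* [eigenspace A a] is a space of row vectors. For a normal [A] it is the set of
   the conjugate transposes of the column vectors [v] such that [A *m v = a *: v],
   and the matrix of its orthogonal projection is the same on either side. *)
Definition spectral_proj n (A : 'M[C]_n) (a : C) : 'M[C]_n :=
  proj_ortho (eigenspace A a).

(* The functional calculus of Hermitian matrices, whose eigenvalues are real. *)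
Definition fun_mx (f : R -> R) n (A : 'M[C]_n) : 'M[C]_n :=
  \sum_(a <- eigvals A) (f (complex.Re a))%:C *: spectral_proj A a.

Definition abs_mx n (T : 'M[C]_n) : 'M[C]_n := fun_mx Num.sqrt (T^t* *m T).

(* The polar factor of an invertible matrix: see [polar_decomp]. *)
Definition polar_mx n (T : 'M[C]_n) : 'M[C]_n := T *m invmx (abs_mx T).

Definition centered_family n (T : 'M[C]_n) : set 'M[C]_n :=
  [set A | [\/ exists2 k, (0 < k)%N &
                 A = (polar_mx T)^t* ^+ k *m abs_mx T *m polar_mx T ^+ k,
               A = abs_mx T |
               exists2 k, (0 < k)%N &
                 A = polar_mx T ^+ k *m abs_mx T *m (polar_mx T)^t* ^+ k]].

Definition centered n (T : 'M[C]_n) : Prop :=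
  forall A B, centered_family T A -> centered_family T B -> A *m B = B *m A.

(* [f] is only used on positive reals; its values elsewhere are irrelevant. *)
Definition operator_monotone (f : R -> R) : Prop :=
  forall n (A B : 'M[C]_n), posdef A -> posdef B ->
    loewner_le A B -> loewner_le (fun_mx f A) (fun_mx f B).

Definition representing_function (f : R -> R) : Prop :=
  [/\ forall x, 0 < x -> 0 < f x, operator_monotone f & f 1 = 1].

Definition aluthge (f : R -> R) n (T : 'M[C]_n) : 'M[C]_n :=
  \sum_(a <- eigvals (abs_mx T)) \sum_(b <- eigvals (abs_mx T))
    (complex.Re a * f (complex.Re b / complex.Re a))%:C *:
      (spectral_proj (abs_mx T) a *m polar_mx T *m spectral_proj (abs_mx T) b).

Lemma spectralE n (A : 'M[C]_n) : A \is normalmx ->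
  A = (spectralmx A)^t* *m diag_mx (spectral_diag A) *m spectralmx A.
Proof.
move=> /orthomx_spectralP {1}->.
by rewrite invmx_unitary ?spectral_unitarymx.
Qed.

Lemma row_diag_mul n p (d : 'rV[C]_n) (M : 'M[C]_(n, p)) i :
  row i (diag_mx d *m M) = d ord0 i *: row i M.
Proof. by rewrite mul_diag_mx; apply/rowP => j; rewrite !mxE. Qed.

Lemma row_spectral n (A : 'M[C]_n) i : A \is normalmx ->
  row i (spectralmx A) *m A = spectral_diag A ord0 i *: row i (spectralmx A).
Proof.
move=> /spectralE AE; rewrite -row_mul {2}AE !mulmxA.
by rewrite (unitarymxP (spectral_unitarymx A)) mul1mx row_diag_mul.
Qed.

Lemma row_spectral_adj n (A : 'M[C]_n) i : A \is normalmx ->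
  row i (spectralmx A) *m A^t* =
    (spectral_diag A ord0 i)^* *: row i (spectralmx A).
Proof.
move=> /spectralE AE; rewrite -row_mul {2}AE !trmx_mul !map_mxM trmxCK !mulmxA.
rewrite (unitarymxP (spectral_unitarymx A)) mul1mx tr_diag_mx map_diag_mx.
by rewrite row_diag_mul mxE.
Qed.

Lemma mem_eigvals n (A : 'M[C]_n) a : A \is normalmx ->
  (a \in eigvals A) = eigenvalue A a.
Proof.
move=> An; have Pu := spectral_unit A; rewrite mem_undup.
apply/mapP/eigenvalueP => [[i _ ->]|[v vA v0]].
  exists (row i (spectralmx A)); first exact: row_spectral.
  apply/negP => /eqP ri0.
  have /rowP/(_ i) : row i (spectralmx A *m invmx (spectralmx A)) = 0.
    by rewrite row_mul ri0 mul0mx.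
  by rewrite mulmxV // !mxE eqxx => /eqP; rewrite oner_eq0.
pose w := v *m invmx (spectralmx A).
have wP : w *m spectralmx A = v by rewrite mulmxKV.
have wD : w *m diag_mx (spectral_diag A) = a *: w.
  have /orthomx_spectralP AE := An.
  have AP : A *m invmx (spectralmx A) =
      invmx (spectralmx A) *m diag_mx (spectral_diag A).
    by rewrite {1}AE mulmxK.
  by rewrite /w scalemxAl -vA -[RHS]mulmxA AP mulmxA.
clearbody w; have [i wi0] : exists i, w ord0 i != 0.
  apply/rV0Pn; apply: contraNneq v0 => w0.
  by rewrite -wP w0 mul0mx.
exists i; first by rewrite mem_enum.
move/rowP: wD => /(_ i); rewrite mul_mx_diag !mxE mulrC => /eqP.
by rewrite -subr_eq0 -mulrBl mulf_eq0 (negPf wi0) orbF subr_eq0 => /eqP.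
Qed.

Lemma spectral_projE n (A : 'M[C]_n) a : A \is normalmx ->
  spectral_proj A a =
    (spectralmx A)^t* *m
      diag_mx (\row_i (spectral_diag A ord0 i == a)%:R) *m spectralmx A.
Proof.
move=> An; have Pu := spectral_unit A.
rewrite -(invmx_unitary (spectral_unitarymx A)) -mulmxA.
apply: (canRL (mulKmx Pu)).
apply/row_matrixP => i; rewrite row_mul /spectral_proj row_diag_mul mxE.
case: eqP => [da|/eqP da].
  rewrite scale1r proj_ortho_id //; apply/eigenspaceP.
  by rewrite row_spectral // da.
rewrite scale0r proj_ortho_0 //; apply/orthomx1P.
set r := row _ _; set V := eigenspace A a.
have VA : V *m A = a *: V by apply/eigenspaceP.
have : r *m (V *m A)^t* = (spectral_diag A ord0 i)^* *: (r *m V^t*).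
  by rewrite trmx_mul map_mxM mulmxA row_spectral_adj // -scalemxAl.
rewrite VA linearZ /= map_mxZ -scalemxAr => /eqP.
rewrite -subr_eq0 -scalerBl scaler_eq0 subr_eq0 => /orP[|/eqP//].
by rewrite (inj_eq (can_inj (@conjCK _))) eq_sym (negPf da).
Qed.

Lemma fun_mxE (f : R -> R) n (A : 'M[C]_n) : A \is normalmx ->
  fun_mx f A =
    (spectralmx A)^t* *m
      diag_mx (\row_i (f (complex.Re (spectral_diag A ord0 i)))%:C) *m
      spectralmx A.
Proof.
move=> An; rewrite /fun_mx.
under eq_bigr do rewrite spectral_projE // scalemxAl scalemxAr.
rewrite -mulmx_suml -mulmx_sumr; congr (_ *m _ *m _).
apply/matrixP => i j; rewrite summxE !mxE.
under eq_bigr do rewrite !mxE.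
have [->|_] := eqVneq i j; last by rewrite big1 // => a _; rewrite mulr0n mulr0.
have di : spectral_diag A ord0 j \in eigvals A.
  by rewrite mem_undup; apply: map_f; rewrite mem_enum.
rewrite (bigD1_seq _ di (undup_uniq _)) /= eqxx !mulr1n mulr1 big1 ?addr0 //.
by move=> a /negPf; rewrite eq_sym => ->; rewrite mulr1n mulr0.
Qed.

Lemma polar_decomp n (T : 'M[C]_n) : T \in unitmx ->
  [/\ possemidef (abs_mx T), abs_mx T *m abs_mx T = T^t* *m T,
      polar_mx T \is unitarymx & T = polar_mx T *m abs_mx T].
Proof.
move=> Tu; set H := T^t* *m T; set D := abs_mx T.
have Tsu : T^t* \in unitmx by rewrite map_unitmx unitmx_tr.
have Hadj : H^t* = H by rewrite /H trmx_mul map_mxM trmxCK.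
have Hn : H \is normalmx by apply/normalmxP; rewrite Hadj.
set P := spectralmx H; set d := spectral_diag H.
have Pu : P *m P^t* = 1%:M by apply/unitarymxP/spectral_unitarymx.
have d_ge0 i : 0 <= d ord0 i.
  have dE : d ord0 i = (row i P *m T^t* *m (row i P *m T^t*)^t*) ord0 ord0.
    rewrite trmx_mul map_mxM trmxCK -mulmxA [X in _ *m X]mulmxA -/H mulmxA.
    rewrite row_spectral // -scalemxAl mxE -/P -/d.
    have -> : (row i P *m (row i P)^t*) ord0 ord0 = (P *m P^t*) i i.
      by rewrite !mxE; apply: eq_bigr => k _; rewrite !mxE.
    by rewrite Pu mxE eqxx mulr1.
  rewrite dE mxE; apply: sumr_ge0 => k _.
  by rewrite [X in _ * X]mxE [X in _ * X^*]mxE mul_conjC_ge0.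
pose r : 'rV[C]_n := \row_i (Num.sqrt (complex.Re (d ord0 i)))%:C.
have DE : D = P^t* *m diag_mx r *m P by rewrite /D /abs_mx fun_mxE.
have HE : H = P^t* *m diag_mx d *m P := spectralE Hn.
have rE i : r ord0 i = (Num.sqrt (complex.Re (d ord0 i)))%:C by rewrite mxE.
clearbody P d r.
have r_ge0 i : 0 <= r ord0 i by rewrite rE lecR sqrtr_ge0.
have DD : D *m D = H.
  rewrite DE -!mulmxA (mulmxA P) Pu mul1mx (mulmxA (diag_mx r)) mulmx_diag.
  rewrite mulmxA [RHS]HE; congr (_ *m diag_mx _ *m _).
  apply/rowP => i; rewrite mxE rE -rmorphM /= -expr2.
  have := d_ge0 i; case: (d ord0 i) => x y; rewrite lecE /= => /andP[/eqP -> x0].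
  by rewrite sqr_sqrtr.
have Dadj : D^t* = D.
  rewrite DE !trmx_mul !map_mxM trmxCK tr_diag_mx map_diag_mx mulmxA.
  congr (_ *m diag_mx _ *m _); apply/rowP => i; rewrite mxE.
  by apply/CrealP; apply: ger0_real.
have Du : D \in unitmx.
  have : D *m D \in unitmx by rewrite DD unitmx_mul Tsu Tu.
  by rewrite unitmx_mul => /andP[].
split => //.
- move=> v; rewrite DE.
  have -> : v^t* *m (P^t* *m diag_mx r *m P) *m v =
      (P *m v)^t* *m (diag_mx r *m (P *m v)).
    by rewrite trmx_mul map_mxM !mulmxA.
  move: (P *m v) => w; rewrite mul_diag_mx mxE.
  apply: sumr_ge0 => k _; rewrite !mxE mulrCA.
  by apply: mulr_ge0 => //; rewrite mulrC mul_conjC_ge0.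
- rewrite -trmxC_unitary; apply/unitarymxP; rewrite trmxCK /polar_mx -/D.
  rewrite trmx_mul map_mxM trmx_inv map_invmx Dadj -mulmxA.
  by rewrite [X in _ *m X]mulmxA -/H -DD mulmxK // mulVmx.
- by rewrite /polar_mx mulmxKV.
Qed.

End MatrixFunctions.

Arguments aluthge {R} f {n} T.

(* Main.v *)
Require Import Defs.
From mathcomp Require Import all_boot all_order all_algebra.
From mathcomp Require Import fingroup perm.
From mathcomp Require Import all_classical all_reals all_analysis.
From mathcomp Require Import complex ring.
Import Order.TTheory GRing.Theory Num.Theory.
Import numFieldNormedType.Exports.
Local Open Scope classical_set_scope.
Local Open Scope ring_scope.

(** Write [T = U |T|]. Centeredness makes the matrices [B_k = U*^k |T| U^k]
    commute, so some unitary [W] diagonalizes all of them at once. This infinite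
    family is handled through a finite one: by the Cayley-Hamilton theorem for
    [X |-> U* X U], the sequence [B] satisfies a linear recurrence
    ([conj_orbit_recurrence]).

    In the basis given by [W], the relation [B_k U = U B_(k+1)] says that [U]
    has a nonzero entry [(i, j)] only if the [i]-th eigenvalue of [B_k] is the
    [j]-th eigenvalue of [B_(k+1)] for all [k]. As [det U] is nonzero, there is
    a permutation of the indices along which all entries of [U] are nonzero, and
    with [t] its inverse, the eigenvalues of [B_k] are [a (t^k i)], where [a]
    lists those of [|T|]. Hence [a (t^k i) = a (t^(k+1) j)] whenever
    [U i j <> 0] ([shift_compatible]). For such a [T], the Aluthge transform
    keeps [U] and replaces [a i] by the mean of [a (t i)] and [a i]
    ([aluthge_step]), and the new eigenvalues are again compatible with [U]. The
    iteration of matrices is thus an iteration of positive vectors, with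
    [a_(n+1) i <= (1 - lambda) a_n (t i) + lambda a_n i].

    Such vectors converge to a [t]-invariant one ([dissipative_cvg]). Indeed the
    identity
      [((1 - l) x + l y)^2 = (1 - l) x^2 + l y^2 - l (1 - l) (x - y)^2]
    shows that the sum of the squares decreases by at least a fixed multiple of
    [(a_n (t i) - a_n i)^2], so that these gaps tend to [0]; and the sum of
    [a_n] over each orbit of [t] is nonincreasing, hence converges. A compatible
    and [t]-invariant limit is a diagonal matrix that commutes with [U], so the
    limit matrix is normal ([normal_shift_invariant]). *)

Set Implicit Arguments.
Unset Strict Implicit.
Unset Printing Implicit Defensive.

(** * Convergence of subaveraging iterations along a permutation *)

Lemma cvg_sqr0 (R : realType) (u : R ^nat) :
  u n ^+ 2 @[n --> \oo] --> 0 -> u @ \oo --> 0.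
Proof.
move=> u0; apply/cvgr0Pnorm_lt => e e0.
have e20 : 0 < e ^+ 2 by rewrite exprn_gt0.
move/cvgr0Pnorm_lt : u0 => /(_ _ e20); apply: filterS => n.
by rewrite normrX ltr_pXn2r ?nnegrE // ltW.
Qed.

Section Dissipation.
Variables (R : realType) (I : finType) (t : {perm I}) (lambda : R).
Variable a : nat -> I -> R.
Hypothesis lambda01 : 0 < lambda < 1.
Hypothesis a_ge0 : forall n i, 0 <= a n i.
Hypothesis a_step :
  forall n i, a n.+1 i <= (1 - lambda) * a n (t i) + lambda * a n i.

(** The energy [E] below is nonnegative and nonincreasing, so its decrements
    tend to [0], and each decrement bounds the square of the gap at [i] up to a
    constant. *)
Lemma gap_cvg0 i : (a n (t i) - a n i) @[n --> \oo] --> 0.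
Proof.
have /andP[l0 l1] := lambda01.
pose E n := \sum_j a n j ^+ 2.
have Edec n : E n.+1 + lambda * (1 - lambda) * (a n (t i) - a n i) ^+ 2 <= E n.
  have Et : E n = (1 - lambda) * (\sum_j a n (t j) ^+ 2) +
                  lambda * (\sum_j a n j ^+ 2).
    have <- : E n = \sum_j a n (t j) ^+ 2 by exact: (reindex_inj (@perm_inj _ t)).
    by rewrite -/(E n); ring.
  rewrite Et /E !mulr_sumr -big_split /= (bigD1 i) //= [leRHS](bigD1 i) //=.
  have step j : a n.+1 j ^+ 2 <= (1 - lambda) * a n (t j) ^+ 2 +
      lambda * a n j ^+ 2 - lambda * (1 - lambda) * (a n (t j) - a n j) ^+ 2.
    have -> : (1 - lambda) * a n (t j) ^+ 2 + lambda * a n j ^+ 2 -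
        lambda * (1 - lambda) * (a n (t j) - a n j) ^+ 2 =
        ((1 - lambda) * a n (t j) + lambda * a n j) ^+ 2 by ring.
    by rewrite lerXn2r ?nnegrE ?a_step // (le_trans (a_ge0 n.+1 j)).
  rewrite addrAC lerD //; first by rewrite -lerBrDr step.
  apply: ler_sum => j _; apply: (le_trans (step j)).
  rewrite gerBl; apply: mulr_ge0; last exact: sqr_ge0.
  by rewrite mulr_ge0 ?subr_ge0 ?ltW.
have c0 : 0 < lambda * (1 - lambda) by rewrite mulr_gt0 ?subr_gt0.
have Enon : nonincreasing_seq E.
  apply/nonincreasing_seqP => n; apply: le_trans (Edec n).
  by rewrite lerDl mulr_ge0 ?sqr_ge0 // ltW.
have [e Ee] : exists e : R, E @ \oo --> e.
  exists (limn E); apply: nonincreasing_is_cvgn => //.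
  by exists 0 => _ [n _ <-]; apply: sumr_ge0 => j _; exact: sqr_ge0.
have ES : (fun n => E n.+1) @ \oo --> e by rewrite (cvg_shiftS E).
apply: (@cvg_sqr0 R (fun n => a n (t i) - a n i)).
have dE0 : (lambda * (1 - lambda))^-1 * (E n - E n.+1) @[n --> \oo] --> 0.
  rewrite -(mulr0 (lambda * (1 - lambda))^-1) -(subrr e).
  by apply: cvgM; [exact: cvg_cst|exact: cvgB].
apply: (squeeze_cvgr _ (cvg_cst 0) dE0).
near=> n.
by rewrite sqr_ge0 /= ler_pdivlMl // lerBrDl Edec.
Unshelve. all: by end_near. Qed.

(** The sum over the orbit [O] of [i] is a convergent sequence, and it differs
    from [#|O|] times the value at [i] by a sum of gaps, which tends to [0]. *)
Lemma dissipative_cvg : exists l : I -> R,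
  (forall i, l (t i) = l i) /\ (forall i, a n i @[n --> \oo] --> l i).
Proof.
have gapX i k : (a n ((t ^+ k)%g i) - a n i) @[n --> \oo] --> 0.
  elim: k => [|k IHk].
    under eq_fun do rewrite expg0 perm1 subrr; exact: cvg_cst.
  rewrite -(addr0 0).
  have -> : (fun n => a n ((t ^+ k.+1)%g i) - a n i) = (fun n =>
      (a n (t ((t ^+ k)%g i)) - a n ((t ^+ k)%g i)) +
      (a n ((t ^+ k)%g i) - a n i)).
    by apply/funext => n; rewrite expgSr permM subrKA.
  by apply: cvgD => //; exact: gap_cvg0.
have acvg i : exists l : R, a n i @[n --> \oo] --> l.
  pose O := porbit t i; pose S n := \sum_(j in O) a n j.
  have Snon : nonincreasing_seq S.
    apply/nonincreasing_seqP => n.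
    have -> : S n = (1 - lambda) * (\sum_(j in O) a n (t j)) +
                    lambda * (\sum_(j in O) a n j).
      have -> : \sum_(j in O) a n (t j) = S n.
        rewrite /S [RHS](reindex_inj (@perm_inj _ t)) /=; apply: eq_bigl => j.
        rewrite /O -!eq_porbit_mem.
        by rewrite -[t j](congr1 (fun s : {perm I} => s j) (expg1 t)) porbit_perm.
      by rewrite -/(S n); ring.
    by rewrite !mulr_sumr -big_split /=; apply: ler_sum => j _.
  have [s Ss] : exists s : R, S @ \oo --> s.
    exists (limn S); apply: nonincreasing_is_cvgn => //.
    by exists 0 => _ [n _ <-]; apply: sumr_ge0.
  have O0 : #|O|%:R != 0 :> R.
    by rewrite pnatr_eq0 -lt0n; apply/card_gt0P; exists i; exact: porbit_id.
  exists (#|O|%:R^-1 * (s - \sum_(j in O) 0)).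
  have -> : (fun n => a n i) =
      (fun n => #|O|%:R^-1 * (S n - \sum_(j in O) (a n j - a n i))).
    apply/funext => n; rewrite sumrB sumr_const opprB addrC subrK.
    by rewrite -(mulr_natl (a n i)) mulKf.
  apply: cvgM; first exact: cvg_cst.
  apply: cvgB => //; apply: cvg_big => [|j /porbitP[k ->]].
  - exact: add_continuous.
  - exact: gapX.
have [l al] := choice acvg; exists l; split => // i.
apply/eqP; rewrite -subr_eq0; apply/eqP.
rewrite -(cvg_lim (@Rhausdorff R) (gap_cvg0 i)).
by symmetry; apply: (cvg_lim (@Rhausdorff R)); exact: cvgB.
Qed.
End Dissipation.

(** * Unitary conjugation *)

Lemma iter_mulmx (K : pzSemiRingType) n (P H Q : 'M[K]_n) k :
  iter k (fun X => P *m X *m Q) H = P ^+ k *m H *m Q ^+ k.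
Proof.
elim: k => [|k IHk]; first by rewrite !expr0 mul1mx mulmx1.
by rewrite iterS IHk exprS exprSr !mulmxA.
Qed.

Section UnitaryConjugation.
Local Open Scope sesquilinear_scope.
Variable C : numClosedFieldType.

Lemma adjM p q r (X : 'M[C]_(p, q)) (Y : 'M[C]_(q, r)) :
  (X *m Y)^t* = Y^t* *m X^t*.
Proof. by rewrite trmx_mul map_mxM. Qed.

Variable n : nat.
Implicit Types (D H P U W X Y : 'M[C]_n) (d e : 'rV[C]_n).

Lemma mul_adj_unitary W : W \is unitarymx -> W^t* *m W = 1%:M.
Proof. by move=> Wu; rewrite -[W^t*]mul1mx mulmxKtV. Qed.

Lemma mul_conj W X Y : W \is unitarymx ->
  (W^t* *m X *m W) *m (W^t* *m Y *m W) = W^t* *m (X *m Y) *m W.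
Proof. by move=> Wu; rewrite !mulmxA mulmxtVK. Qed.

Lemma adj_conj W X : (W^t* *m X *m W)^t* = W^t* *m X^t* *m W.
Proof. by rewrite !adjM trmxCK mulmxA. Qed.

Lemma unitarymx_conj W U : W \is unitarymx -> U \is unitarymx ->
  W *m U *m W^t* \is unitarymx.
Proof. by move=> Wu Uu; rewrite !mul_unitarymx ?trmxC_unitary. Qed.

Lemma mul_conjr W U D : W \is unitarymx ->
  U *m (W^t* *m D *m W) = W^t* *m ((W *m U *m W^t*) *m D) *m W.
Proof. by move=> Wu; rewrite !mulmxA mul_adj_unitary // mul1mx. Qed.

Lemma conj_diag_normal W d : W \is unitarymx ->
  W^t* *m diag_mx d *m W \is normalmx.
Proof.
move=> Wu; apply/normalmxP; rewrite adj_conj tr_diag_mx map_diag_mx.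
by rewrite !(mul_conj _ _ Wu) diag_mxC.
Qed.

Lemma conj_polar_normal W U D : W \is unitarymx -> U \is unitarymx ->
  D^t* = D -> U *m D = D *m U -> W^t* *m (U *m D) *m W \is normalmx.
Proof.
move=> Wu Uu Dh UD; apply/normalmxP; rewrite adj_conj !(mul_conj _ _ Wu).
rewrite adjM Dh; congr (_ *m _ *m _).
have DU : D *m U^t* = U^t* *m D.
  by have := congr1 (fun X => X^t*) UD; rewrite !adjM Dh.
by rewrite {1}UD DU !mulmxA mulmxtVK // -DU mulmxKtV.
Qed.

Lemma gram_polar W U D : W \is unitarymx -> U \is unitarymx ->
  (W^t* *m (U *m D) *m W)^t* *m (W^t* *m (U *m D) *m W) =
  W^t* *m (D^t* *m D) *m W.
Proof.
move=> Wu Uu; rewrite adj_conj (mul_conj _ _ Wu) adjM.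
by rewrite [X in _ *m X *m _]mulmxA mulmxKtV.
Qed.

(** Functional calculus does not depend on the diagonalization: the change of
    basis [X = P W*] satisfies [d i * X i j = X i j * e j], so that [d i = e j]
    wherever [X i j <> 0], and the same relation holds for [h d] and [h e]. *)
Lemma diag_calculus_unique (h : C -> C) P W d e :
  P \is unitarymx -> W \is unitarymx ->
  P^t* *m diag_mx d *m P = W^t* *m diag_mx e *m W ->
  P^t* *m diag_mx (map_mx h d) *m P = W^t* *m diag_mx (map_mx h e) *m W.
Proof.
move=> Pu Wu PW; pose X := P *m W^t*.
have dX : diag_mx d *m X = X *m diag_mx e.
  rewrite /X mulmxA -[_ *m P]mul1mx -(unitarymxP Pu) -(mulmxA P).
  by rewrite [_ *m (_ *m P)]mulmxA PW -!mulmxA (unitarymxP Wu) mulmx1.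
have hX : diag_mx (map_mx h d) *m X = X *m diag_mx (map_mx h e).
  apply/matrixP => i j; move/matrixP/(_ i j): dX.
  rewrite !mul_diag_mx !mul_mx_diag !mxE mulrC.
  have [->|X0] := eqVneq (\sum_k P i k * (W^t*) k j) 0.
    by rewrite !mulr0 !mul0r.
  by move=> /(mulfI X0) ->; rewrite mulrC.
rewrite -[LHS](mulmxKtV _ Wu (erefl n)) -[_ *m P *m _]mulmxA -/X.
by rewrite -[_ *m _ *m X]mulmxA hX /X !mulmxA (mul_adj_unitary Pu) mul1mx.
Qed.

(** Otherwise every term of the Leibniz expansion of the determinant vanishes. *)
Lemma unitmx_perm_neq0 U : U \in unitmx ->
  exists s : 'S_n, forall i, U i (s i) != 0.
Proof.
rewrite unitmxE unitfE => detU.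
have [/existsP[s /forallP]|/existsPn noperm] :=
  boolP [exists s : 'S_n, [forall i, U i (s i) != 0]]; first by exists s.
case/eqP: detU; rewrite /determinant big1 // => s _.
move: (noperm s); rewrite negb_forall => /existsP[i /negPn/eqP Ui0].
by rewrite (bigD1 i) //= Ui0 mul0r mulr0.
Qed.
End UnitaryConjugation.

(** * Simultaneous diagonalization of a conjugation orbit *)

Section Codiagonalization.
Local Open Scope sesquilinear_scope.
Variable C : numClosedFieldType.

(** The map [X |-> U* X U] is linear on a finite dimensional space; its matrix
    [G] is annihilated by its monic characteristic polynomial, whose
    coefficients are those of the recurrence. *)
Lemma conj_orbit_recurrence n (U : 'M[C]_n) (B : nat -> 'M[C]_n) :
  (forall k, B k.+1 = U^t* *m B k *m U) ->
  exists N (c : nat -> C),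
    forall k, B (N + k)%N = \sum_(i < N) c i *: B (i + k)%N.
Proof.
case: n U B => [|n] U B BS.
  by exists 0%N, (fun=> 0) => k; rewrite flatmx0 [RHS]flatmx0.
pose G := lin_mulmx (U^t*) *m lin_mulmxr U.
have BG i k : mxvec (B k) *m G ^+ i = mxvec (B (i + k)%N).
  elim: i => [|i IHi]; first by rewrite expr0 mulmx1.
  by rewrite exprSr mulmxA IHi addSn BS mulmxA !mul_vec_lin.
pose p := char_poly G; pose N := (n.+1 * n.+1)%N.
have szp : size p = N.+1 by exact: size_char_poly.
have pN : p`_N = 1.
  by have /monicP := char_poly_monic G; rewrite lead_coefE szp.
exists N, (fun i => - p`_i) => k.
have : mxvec (B k) *m horner_mx G p = 0 by rewrite Cayley_Hamilton mulmx0.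
rewrite /horner_mx /= /horner_morph horner_coef size_map_poly_id0; last first.
  by rewrite lead_coefE szp pN; exact: oner_neq0.
rewrite szp mulmx_sumr big_ord_recr /=.
have term i : mxvec (B k) *m ((map_poly scalar_mx p)`_i * G ^+ i) =
    mxvec (p`_i *: B (i + k)%N).
  by rewrite coef_map /= mulmxA mul_mx_scalar -scalemxAl BG linearZ.
rewrite (eq_bigr (fun i : 'I_N => mxvec (p`_i *: B (i + k)%N))); last first.
  by move=> i _; exact: term.
rewrite term pN scale1r -raddf_sum -raddfD /=.
move=> /(congr1 (@vec_mx C n.+1 n.+1)); rewrite mxvecK linear0 => /eqP.
rewrite addrC addr_eq0 => /eqP ->.
by rewrite -sumrN; apply: eq_bigr => i _; rewrite scaleNr.
Qed.

(** A unitary [W] that makes finitely many commuting Hermitian matrices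
    triangular makes them diagonal; the recurrence propagates this to the whole
    sequence. *)
Lemma conj_orbit_codiagonalizable n (U : 'M[C]_n) (B : nat -> 'M[C]_n) :
  (forall k, B k.+1 = U^t* *m B k *m U) ->
  (forall k, (B k)^t* = B k) ->
  (forall k l, B k *m B l = B l *m B k) ->
  exists2 W : 'M[C]_n, W \is unitarymx &
    forall k, is_diag_mx (W *m B k *m W^t*).
Proof.
move=> BS Bh Bcomm; have [N [c BN]] := conj_orbit_recurrence BS.
have [|W Wu /allP Wtrig] := @cotrigonalization C n [seq B k | k <- iota 0 N].
  by move=> _ _ /mapP[k _ ->] /mapP[l _ ->]; exact: Bcomm.
exists W => //; elim/ltn_ind => k IHk.
apply/is_diag_mxP => i j ij; have [kN|Nk] := ltnP k N.
  have : is_trig_mx (W *m B k *m W^t*).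
    rewrite -conjymx //; apply: (Wtrig (B k)); apply: map_f.
    by rewrite mem_iota.
  move/is_trig_mxP => trig.
  have Mh : (W *m B k *m W^t*)^t* = W *m B k *m W^t*.
    by rewrite !adjM trmxCK Bh mulmxA.
  move: (W *m _ *m _) Mh trig => M Mh trig.
  move: ij; rewrite neq_ltn => /orP[/trig//|/trig ji].
  by rewrite -Mh !mxE ji conjC0.
rewrite -(subnKC Nk) BN mulmx_sumr mulmx_suml summxE big1 // => l _.
rewrite -scalemxAr -scalemxAl mxE.
have /IHk/is_diag_mxP -> // : (l + (k - N) < k)%N; last by rewrite mulr0.
by rewrite -{2}(subnKC Nk) ltn_add2r.
Qed.

(** Comparing the entries of [B k *m U = U *m B k.+1] in the basis given by [W]
    shows that an entry [(i, j)] of [U] is zero unless, for all [k], the [i]-th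
    eigenvalue of [B k] is the [j]-th eigenvalue of [B k.+1]. A permutation
    along which [U] has no zero entry then expresses the eigenvalues of all the
    [B k] in terms of those of [H]; [t] is its inverse. *)
Lemma conj_orbit_normal_form n (U H : 'M[C]_n) :
  let B k := iter k (fun X => U^t* *m X *m U) H in
  U \is unitarymx -> H^t* = H ->
  (forall k l, B k *m B l = B l *m B k) ->
  exists (W : 'M[C]_n) (d : 'rV[C]_n) (t : {perm 'I_n}),
    [/\ W \is unitarymx, H = W^t* *m diag_mx d *m W &
        forall i j, (W *m U *m W^t*) i j != 0 -> forall k,
          d ord0 (iter k t i) = d ord0 (iter k.+1 t j)].
Proof.
move=> B Uu Hh Bcomm.
have B0 : B 0%N = H by [].
have BS k : B k.+1 = U^t* *m B k *m U by [].
clearbody B.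
have Bh k : (B k)^t* = B k.
  by elim: k => [|k IHk]; rewrite ?B0 // BS adj_conj IHk.
have [W Wu Wdiag] := conj_orbit_codiagonalizable BS Bh Bcomm.
pose V := W *m U *m W^t*; pose b k : 'rV[C]_n := \row_i (W *m B k *m W^t*) i i.
have bE k : W *m B k *m W^t* = diag_mx (b k).
  apply/matrixP => i j; rewrite [RHS]mxE [X in X *+ _]mxE.
  have [->|ij] := eqVneq i j; first by rewrite mulr1n.
  by rewrite mulr0n (is_diag_mxP (Wdiag k)).
have bV k i j : V i j != 0 -> b k ord0 i = b k.+1 ord0 j.
  move=> Vij; apply: (mulIf Vij).
  have /matrixP/(_ i j) : diag_mx (b k) *m V = V *m diag_mx (b k.+1).
    rewrite -!bE /V !mulmxA !mulmxKtV //; congr (_ *m _).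
    by rewrite BS !mulmxA mulmxtVK.
  by rewrite mul_diag_mx mul_mx_diag !mxE [RHS]mulrC.
have [s Vs] : exists s : 'S_n, forall i, V i (s i) != 0.
  by apply: unitmx_perm_neq0; apply: unitarymx_unit; exact: unitarymx_conj.
pose t := (s^-1)%g.
have bt k j : b k ord0 j = b 0%N ord0 (iter k t j).
  elim: k j => [//|k IHk] j; rewrite iterSr -IHk; symmetry; apply: bV.
  by have := Vs (t j); rewrite permKV.
exists W, (b 0%N), t; split => //.
  rewrite -bE B0 !mulmxA mul_adj_unitary // mul1mx -mulmxA.
  by rewrite mul_adj_unitary // mulmx1.
by move=> i j Vij k; rewrite -!bt; exact: bV.
Qed.
End Codiagonalization.

(** * The Aluthge transform in polar form *)

Section PolarForm.
Local Open Scope complex_scope.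
Local Open Scope sesquilinear_scope.
Variable R : realType.
Local Notation C := R[i].
Variable n : nat.
Implicit Types (U W T : 'M[C]_n) (a : 'I_n -> R).

Section Diagonalized.
Variables (W : 'M[C]_n) (d : 'rV[C]_n).
Hypothesis Wu : W \is unitarymx.
Local Notation A := (W^t* *m diag_mx d *m W).

Lemma spectral_proj_diag b : spectral_proj A b =
  W^t* *m diag_mx (map_mx (fun x => (x == b)%:R) d) *m W.
Proof.
have An := conj_diag_normal d Wu; rewrite (spectral_projE b An).
have -> : \row_i (spectral_diag A ord0 i == b)%:R =
    map_mx (fun x => (x == b)%:R : C) (spectral_diag A).
  by apply/rowP => i; rewrite !mxE.
apply: (diag_calculus_unique _ (spectral_unitarymx A) Wu).
exact: esym (spectralE An).
Qed.

Lemma fun_mx_diag (h : R -> R) : fun_mx h A =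
  W^t* *m diag_mx (map_mx (fun x => (h (complex.Re x))%:C) d) *m W.
Proof.
have An := conj_diag_normal d Wu; rewrite (fun_mxE h An).
have -> : \row_i (h (complex.Re (spectral_diag A ord0 i)))%:C =
    map_mx (fun x => (h (complex.Re x))%:C : C) (spectral_diag A).
  by apply/rowP => i; rewrite !mxE.
apply: (diag_calculus_unique _ (spectral_unitarymx A) Wu).
exact: esym (spectralE An).
Qed.

Lemma mem_eigvals_diag i : d ord0 i \in eigvals A.
Proof.
rewrite (mem_eigvals _ (conj_diag_normal d Wu)).
apply/eigenvalueP; exists (row i W).
  by rewrite -row_mul !mulmxA (unitarymxP Wu) mul1mx row_diag_mul.
apply/eqP => ri0.
have /rowP/(_ i) : row i (W *m W^t*) = 0 by rewrite row_mul ri0 mul0mx.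
by rewrite (unitarymxP Wu) !mxE eqxx => /eqP; rewrite oner_eq0.
Qed.

(** The quadratic form of [A] at the [i]-th column of [W*] is [d i]. *)
Lemma posdef_diag_gt0 : posdef A -> forall i, 0 < d ord0 i.
Proof.
move=> [Hpos Hunit] i.
have WHW : W *m A *m W^t* = diag_mx d.
  by rewrite !mulmxA mulmxtVK // (unitarymxP Wu) mul1mx.
rewrite lt_neqAle; apply/andP; split.
  have : diag_mx d \in unitmx.
    by move: Hunit; rewrite !unitmx_mul => /andP[/andP[]].
  rewrite unitmxE det_diag unitfE prodf_seq_neq0 => /allP/(_ i).
  by rewrite mem_index_enum eq_sym; exact.
have := Hpos ((row i W)^t*); rewrite trmxCK.
set H := _ *m W in WHW *.
have -> : row i W *m H *m (row i W)^t* = row i (col i (W *m H *m W^t*)).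
  apply/matrixP => x y; rewrite !ord1 -row_mul !mxE.
  by apply: eq_bigr => j _; rewrite !mxE.
by rewrite WHW !mxE eqxx mulr1n.
Qed.
End Diagonalized.

Definition realdiag a : 'M[C]_n := diag_mx (\row_i (a i)%:C).

Lemma realdiag_adj a : (realdiag a)^t* = realdiag a.
Proof.
rewrite /realdiag tr_diag_mx map_diag_mx; congr diag_mx.
by apply/rowP => i; rewrite !mxE; exact: conjc_real.
Qed.

Lemma realdiagM a b : realdiag a *m realdiag b = realdiag (fun i => a i * b i).
Proof.
rewrite /realdiag mulmx_diag; congr diag_mx.
by apply/rowP => i; rewrite !mxE rmorphM.
Qed.

Lemma abs_mx_adj T : (abs_mx T)^t* = abs_mx T.
Proof.
have Hn : T^t* *m T \is normalmx by apply/normalmxP; rewrite adjM trmxCK.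
by rewrite /abs_mx (fun_mxE _ Hn) adj_conj (realdiag_adj (fun i => _)).
Qed.

Section Aluthge.
Variables (W U : 'M[C]_n) (a : 'I_n -> R).
Hypotheses (Wu : W \is unitarymx) (Uu : U \is unitarymx).
Hypothesis a_gt0 : forall i, 0 < a i.
Local Notation T := (W^t* *m (U *m realdiag a) *m W).

Lemma abs_mx_polar_form : abs_mx T = W^t* *m realdiag a *m W.
Proof.
rewrite /abs_mx (gram_polar (realdiag a) Wu Uu) realdiag_adj realdiagM.
rewrite (fun_mx_diag _ Wu) /realdiag.
have -> : map_mx (fun x => (Num.sqrt (complex.Re x))%:C : C)
    (\row_i (a i * a i)%:C) = \row_i (a i)%:C.
  by apply/rowP => i; rewrite !mxE /= -expr2 sqrtr_sqr gtr0_norm.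
by [].
Qed.

Lemma polar_mx_polar_form : polar_mx T = W^t* *m U *m W.
Proof.
have Du : abs_mx T \in unitmx.
  have DV : realdiag a *m realdiag (fun i => (a i)^-1) = 1%:M.
    rewrite realdiagM -diag_const_mx; congr diag_mx.
    by apply/rowP => i; rewrite !mxE divff // gt_eqF.
  have Wunit := unitarymx_unit Wu.
  have Wtunit : W^t* \in unitmx by rewrite map_unitmx unitmx_tr.
  by rewrite abs_mx_polar_form !unitmx_mul (mulmx1_unit DV).1 Wunit Wtunit.
have TE : T = W^t* *m U *m W *m abs_mx T.
  by rewrite abs_mx_polar_form; exact: (esym (mul_conj _ _ Wu)).
move: Du TE; rewrite /polar_mx; move: (abs_mx T) => B Bu ->; exact: mulmxK.
Qed.

(** In the basis given by [W], the spectral projections of [|T|] are diagonal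
    0-1 matrices, so the double sum acts on [U] as an entrywise multiplication. *)
Lemma aluthge_polar_form (f : R -> R) : aluthge f T =
  W^t* *m (\matrix_(i, j) ((a i * f (a j / a i))%:C * U i j)) *m W.
Proof.
rewrite /aluthge polar_mx_polar_form abs_mx_polar_form.
set s := eigvals _.
have as_ i : (a i)%:C \in s.
  by have := mem_eigvals_diag (\row_i (a i)%:C) Wu i; rewrite mxE.
have us : uniq s by exact: undup_uniq.
move: s as_ us => s as_ us.
pose D b := diag_mx (map_mx (fun x => (x == b)%:R) (\row_i (a i)%:C)) : 'M[C]_n.
transitivity (W^t* *m (\sum_(b <- s) \sum_(c <- s)
    (complex.Re b * f (complex.Re c / complex.Re b))%:C *:
      (D b *m U *m D c)) *m W).
  rewrite mulmx_sumr mulmx_suml; apply: eq_bigr => b _.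
  rewrite mulmx_sumr mulmx_suml; apply: eq_bigr => c _.
  rewrite !(spectral_proj_diag _ Wu) -/(D b) -/(D c).
  rewrite !(mul_conj _ _ Wu).
  by rewrite -scalemxAr -scalemxAl.
congr (_ *m _ *m _); apply/matrixP => i j; rewrite summxE mxE.
have Dij b c : (D b *m U *m D c) i j =
    ((a i)%:C == b)%:R * U i j * ((a j)%:C == c)%:R.
  by rewrite mul_mx_diag mul_diag_mx !mxE.
rewrite (bigD1_seq _ (as_ i) us) /= [X in _ + X]big1 ?addr0; last first.
  move=> b bi; rewrite summxE big1 // => c _; rewrite mxE Dij eq_sym (negPf bi).
  by rewrite !mul0r mulr0.
rewrite summxE (bigD1_seq _ (as_ j) us) /= big1 ?addr0 => [|c cj]; last first.
  by rewrite mxE Dij [_ == c]eq_sym (negPf cj) !mulr0.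
by rewrite mxE Dij !eqxx mul1r mulr1.
Qed.
End Aluthge.
End PolarForm.

(** * The induced iteration on eigenvalues *)

Section Iteration.
Local Open Scope complex_scope.
Local Open Scope sesquilinear_scope.
Variable R : realType.
Local Notation C := R[i].
Variable n : nat.
Implicit Types (U W T : 'M[C]_n) (a : 'I_n -> R) (t : 'I_n -> 'I_n).

(** The mean [m_f] of the positive numbers [a (t i)] and [a i]. *)
Definition mean_step (f : R -> R) t a : 'I_n -> R :=
  fun i => a (t i) * f (a i / a (t i)).

(** For [k = 0] this is what makes [U] intertwine [a] and [a \o t]. All the
    powers of [t] are included because [mean_step] mixes [a] and [a \o t]: a
    single instance would not be preserved by it. *)
Definition shift_compatible U t a :=
  forall i j, U i j != 0 -> forall k, a (iter k t i) = a (iter k.+1 t j).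

Lemma shift_compatible_step (f : R -> R) U t a :
  shift_compatible U t a -> shift_compatible U t (mean_step f t a).
Proof.
by move=> Uta i j /Uta Uij k; rewrite /mean_step -!iterS !Uij.
Qed.

Lemma mean_step_gt0 (f : R -> R) t a : (forall x, 0 < x -> 0 < f x) ->
  (forall i, 0 < a i) -> forall i, 0 < mean_step f t a i.
Proof. by move=> f0 a0 i; rewrite mulr_gt0 ?f0 ?divr_gt0. Qed.

Lemma mean_step_le (f : R -> R) (lambda : R) t a :
  (forall x, 0 < x -> f x <= 1 - lambda + lambda * x) ->
  (forall i, 0 < a i) ->
  forall i, mean_step f t a i <= (1 - lambda) * a (t i) + lambda * a i.
Proof.
move=> fle a0 i; have -> : (1 - lambda) * a (t i) + lambda * a i =
    a (t i) * (1 - lambda + lambda * (a i / a (t i))).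
  by field; rewrite gt_eqF.
by rewrite ler_pM2l // fle // divr_gt0.
Qed.

(** Where [U i j <> 0], compatibility gives [a i = a (t j)]: the factor of
    [U i j] then depends on [j] alone, and is [mean_step f t a j]. *)
Lemma aluthge_step (f : R -> R) W U t a :
  W \is unitarymx -> U \is unitarymx -> (forall i, 0 < a i) ->
  shift_compatible U t a ->
  aluthge f (W^t* *m (U *m realdiag a) *m W) =
    W^t* *m (U *m realdiag (mean_step f t a)) *m W.
Proof.
move=> Wu Uu a0 Uta; rewrite (aluthge_polar_form Wu Uu a0).
suff -> : \matrix_(i, j) ((a i * f (a j / a i))%:C * U i j) =
    U *m realdiag (mean_step f t a) by [].
apply/matrixP => i j; rewrite mul_mx_diag !mxE mulrC.
have [->|/Uta/(_ 0%N) /= ->//] := eqVneq (U i j) 0; by rewrite !mul0r.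
Qed.

Lemma iter_mean_step_invariant (f : R -> R) U t a k :
  (forall x, 0 < x -> 0 < f x) ->
  (forall i, 0 < a i) -> shift_compatible U t a ->
  (forall i, 0 < iter k (mean_step f t) a i) /\
  shift_compatible U t (iter k (mean_step f t) a).
Proof.
move=> f0 a0 Uta; elim: k => [//|k [ak0 Utak]].
by split; [exact: mean_step_gt0|exact: shift_compatible_step].
Qed.

Lemma iter_aluthge (f : R -> R) W U t a :
  (forall x, 0 < x -> 0 < f x) ->
  W \is unitarymx -> U \is unitarymx -> (forall i, 0 < a i) ->
  shift_compatible U t a -> forall k,
  iter k (aluthge f) (W^t* *m (U *m realdiag a) *m W) =
    W^t* *m (U *m realdiag (iter k (mean_step f t) a)) *m W.
Proof.
move=> f0 Wu Uu a0 Uta; elim=> [//|k IHk]; rewrite !iterS IHk.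
have [ak0 Utak] := iter_mean_step_invariant k f0 a0 Uta.
exact: aluthge_step.
Qed.

Lemma normal_shift_invariant W U t a :
  W \is unitarymx -> U \is unitarymx -> (forall i, a (t i) = a i) ->
  shift_compatible U t a ->
  W^t* *m (U *m realdiag a) *m W \is normalmx.
Proof.
move=> Wu Uu ta Uta; apply: (conj_polar_normal Wu Uu).
  exact: realdiag_adj.
apply/matrixP => i j; rewrite mul_mx_diag mul_diag_mx !mxE.
have [->|/Uta/(_ 0%N) /= ->] := eqVneq (U i j) 0; first by rewrite mul0r mulr0.
by rewrite ta mulrC.
Qed.

Lemma centered_normal_form T : T \in unitmx -> centered T ->
  exists W U (t : {perm 'I_n}) a,
    [/\ W \is unitarymx, U \is unitarymx, forall i, 0 < a i,
        shift_compatible U t a & T = W^t* *m (U *m realdiag a) *m W].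
Proof.
move=> Tunit Tc; have [Hpos _ Uu TE] := polar_decomp Tunit.
have Hunit : abs_mx T \in unitmx.
  by move: Tunit; rewrite {1}TE unitmx_mul => /andP[].
have Bfam k : centered_family T
    (iter k (fun X => (polar_mx T)^t* *m X *m polar_mx T) (abs_mx T)).
  case: k => [|k]; first exact: Or32.
  by rewrite iter_mulmx; apply: Or31; exists k.+1.
have [|W [d [t [Wu HE dt]]]] := conj_orbit_normal_form Uu (abs_mx_adj T).
  by move=> k l; exact: Tc.
have d0 : forall i, 0 < d ord0 i.
  by apply: (posdef_diag_gt0 Wu); rewrite -HE.
pose a i := complex.Re (d ord0 i).
have dE i : d ord0 i = (a i)%:C.
  rewrite /a; have := d0 i; case: (d ord0 i) => x y.
  by rewrite ltcE => /andP[/eqP /= -> _].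
have aE : realdiag a = diag_mx d.
  by rewrite /realdiag; congr diag_mx; apply/rowP => i; rewrite mxE dE.
exists W, (W *m polar_mx T *m W^t*), t, a; split; first exact: Wu.
- exact: (unitarymx_conj Wu Uu).
- by move=> i; have := d0 i; rewrite dE ltcR.
- by move=> i j Uij k; have := dt i j Uij k; rewrite !dE => -[].
- by rewrite aE -(mul_conjr _ _ Wu) -HE.
Qed.
End Iteration.

(** * Entrywise limits *)

Lemma cvg_mx (T : topologicalType) p q (X : nat -> 'M[T]_(p, q))
    (L : 'M[T]_(p, q)) :
  (forall i j, X k i j @[k --> \oo] --> L i j) -> X @ \oo --> L.
Proof.
move=> XL S [P LP PS].
have : \forall k \near \oo, forall i j, P i j (X k i j).
  apply: filter_forall => i; apply: filter_forall => j.
  exact: (XL i j _ (LP i j)).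
by apply: filterS => k Pk; exact: PS.
Qed.

Section Limit.
Local Open Scope complex_scope.
Variable R : realType.
Local Notation C := R[i].

Lemma cvg_real_complex (u : R ^nat) (l : R) :
  u @ \oo --> l -> (u k)%:C @[k --> \oo] --> l%:C.
Proof.
move=> ul; apply/cvgrPdist_lt => -[e e'] /=; rewrite ltcE /= => /andP[/eqP -> e0].
move/cvgrPdist_lt : ul => /(_ _ e0); apply: filterS => k.
by rewrite -rmorphB /= normc_def /= expr0n addr0 sqrtr_sqr ltcR.
Qed.

Lemma cvg_mul_realdiag n (V U W : 'M[C]_n) (a : nat -> 'I_n -> R)
    (l : 'I_n -> R) :
  (forall i, a k i @[k --> \oo] --> l i) ->
  V *m (U *m realdiag (a k)) *m W @[k --> \oo] --> V *m (U *m realdiag l) *m W.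
Proof.
move=> al; apply: cvg_mx => i j.
have entry b : (V *m (U *m realdiag b) *m W) i j =
    \sum_k ((V *m U) i k * W k j) * (b k)%:C.
  rewrite mulmxA mul_mx_diag mxE; apply: eq_bigr => k _.
  by rewrite [X in X * _]mxE [X in _ * X * _]mxE mulrAC.
rewrite entry; under eq_fun do rewrite entry.
apply: cvg_big => [|k _]; first exact: add_continuous.
by apply: cvgM; [exact: cvg_cst|exact: cvg_real_complex].
Qed.
End Limit.

(** * Convergence of the iterated Aluthge transforms *)

Theorem theorem4p1 (R : realType) (m : nat) (T : 'M[R[i]]_m)
    (f : R -> R) (lambda : R) :
  T \in unitmx ->
  centered T ->
  representing_function f ->
  is_derive (1 : R) (1 : R) f lambda ->
  0 < lambda < 1 ->
  (forall x : R, 0 < x -> f x <= 1 - lambda + lambda * x) ->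
  exists N : 'M[R[i]]_m,
    N \is normalmx /\ iter n (aluthge f) T @[n --> \oo] --> N.
Proof.
move=> Tunit Tc [f0 _ _] _ lambda01 fle.
have [W [U [t [a [Wu Uu a0 Uta TE]]]]] := centered_normal_form Tunit Tc.
pose A k := iter k (mean_step f t) a.
have Ainv k : (forall i, 0 < A k i) /\ shift_compatible U t (A k).
  exact: iter_mean_step_invariant.
have [l [lt Al]] : exists l : 'I_m -> R,
    (forall i, l (t i) = l i) /\ (forall i, A k i @[k --> \oo] --> l i).
  apply: (dissipative_cvg (lambda := lambda)) => // k i.
    exact: ltW ((Ainv k).1 i).
  by apply: mean_step_le => //; exact: (Ainv k).1.
have Utl : shift_compatible U t l.
  move=> i j Uij k; have := Al (iter k t i).
  have -> : (fun k' => A k' (iter k t i)) = (fun k' => A k' (iter k.+1 t j)).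
    by apply/funext => k'; exact: (Ainv k').2.
  move=> /(cvg_lim (@Rhausdorff R)) <-.
  exact: (cvg_lim (@Rhausdorff R) (Al _)).
eexists; split; first exact: (normal_shift_invariant Wu Uu lt Utl).
rewrite TE (funext (iter_aluthge f0 Wu Uu a0 Uta)).
exact: cvg_mul_realdiag.
Qed.
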